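(* Let $0<\alpha\le\infty$ and let $f$ be a real function on $(-\alpha,\alpha)$. (1) For every $n\ge2$, $f\in S_{\mathrm{conv}}^{(n)}(-\alpha,\alpha)$ if and only if $f$ is differentiable on $(-\alpha,\alpha)$ and $f'\in S_{\mathrm{mono}}^{(n)}(-\alpha,\alpha)$. (2) For every $n\ge3$, $f\in S_{\mathrm{mono}}^{(n)}(-\alpha,\alpha)$ if and only if $f$ is differentiable on $(-\alpha,\alpha)$ and $f'\in S_{\mathrm{pos}}^{(n)}(-\alpha,\alpha)$.
   Context: For a real function $f$ on $(-\alpha,\alpha)$ and a real matrix $A=[a_{ij}]$ with all entries in $(-\alpha,\alpha)$, $f[A]:=[f(a_{ij})]$. For real symmetric matrices, $A\ge0$ means positive semidefinite, and $A\ge B$ means $A-B\ge0$. The following are sets of real functions $f$ on $(-\alpha,\alpha)$: - $S_{\mathrm{pos}}^{(n)}(-\alpha,\alpha)$: those with $f[A]\ge0$ for all $A\ge0$ in $M_n(\mathbb{R})$ with entries in $(-\alpha,\alpha)$. - $S_{\mathrm{mono}}^{(n)}(-\alpha,\alpha)$: those for which $A\ge B\ge0$ implies $f[A]\ge f[B]$ for all symmetric $A,B\in M_n(\mathbb{R})$ with entries in $(-\alpha,\alpha)$. - $S_{\mathrm{conv}}^{(n)}(-\alpha,\alpha)$: those for which $A\ge B\ge0$ implies $f[\lambda A+(1-\lambda)B]\le\lambda f[A]+(1-\lambda)f[B]$ for all $0\le\lambda\le1$, for all symmetric $A,B\in M_n(\mathbb{R})$ with entries in $(-\alpha,\alpha)$.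 *)

(* Defs.v *)
From mathcomp Require Import all_boot all_order all_algebra.
From mathcomp Require Import all_classical all_reals all_analysis.
Import Order.TTheory GRing.Theory Num.Theory.
Import numFieldNormedType.Exports.

Set Implicit Arguments.
Unset Strict Implicit.
Unset Printing Implicit Defensive.

Local Open Scope classical_set_scope.
Local Open Scope ring_scope.

Definition psdmx (R : realType) (n : nat) (A : 'M[R]_n) : Prop :=
  A^T = A /\ forall v : 'cV[R]_n, 0 <= (v^T *m A *m v) 0 0.

(* [loewner_le B A] is B <= A; it is only meant for symmetric A and B. *)
Definition loewner_le (R : realType) (n : nat) (B A : 'M[R]_n) : Prop :=
  psdmx (A - B).

Definition sym_itv (R : realType) (alpha : \bar R) : set R :=
  [set x | (- alpha < x%:E < alpha)%E].

Definition entries_in (R : realType) (n : nat) (D : set R) (A : 'M[R]_n) :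
  Prop := forall i j, D (A i j).

(* A real function on (-alpha, alpha) is represented by a total function R -> R.
   The predicates below depend only on its values on (-alpha, alpha), and f[A]
   is [map_mx f A]. *)

Definition S_pos (R : realType) (n : nat) (alpha : \bar R) : set (R -> R) :=
  [set f | forall A : 'M[R]_n, entries_in (sym_itv alpha) A ->
     psdmx A -> psdmx (map_mx f A)].

Definition S_mono (R : realType) (n : nat) (alpha : \bar R) : set (R -> R) :=
  [set f | forall A B : 'M[R]_n, A^T = A -> B^T = B ->
     entries_in (sym_itv alpha) A -> entries_in (sym_itv alpha) B ->
     loewner_le B A -> psdmx B ->
     loewner_le (map_mx f B) (map_mx f A)].

Definition S_conv (R : realType) (n : nat) (alpha : \bar R) : set (R -> R) :=
  [set f | forall A B : 'M[R]_n, A^T = A -> B^T = B ->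
     entries_in (sym_itv alpha) A -> entries_in (sym_itv alpha) B ->
     loewner_le B A -> psdmx B ->
     forall lambda : R, 0 <= lambda <= 1 ->
       loewner_le (map_mx f (lambda *: A + (1 - lambda) *: B))
                  (lambda *: map_mx f A + (1 - lambda) *: map_mx f B)].

Definition differentiable_on (R : realType) (alpha : \bar R) (f : R -> R) :
  Prop := forall x : R, sym_itv alpha x -> derivable f x 1.

(* Main.v *)
Require Import Defs.
From mathcomp Require Import all_boot all_order all_algebra.
From mathcomp Require Import all_classical all_reals all_analysis.
From mathcomp Require Import ring lra.
Import Order.TTheory GRing.Theory Num.Theory.
Import numFieldNormedType.Exports.

(** Write S for the Schur (entrywise) product and [A >= B] for the Loewner order.
    For differentiable [f] the path [f[B + t (A - B)]] has the derivative
    [f'[B + t (A - B)] S (A - B)]. Since Schur products of positive semidefinite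
    matrices are positive semidefinite ([psd_hadamard]), positivity of [f'] makes the
    path increasing, and monotonicity of [f'] makes it convex; this gives the two
    implications from [f'] to [f] by the mean value theorem.

    Conversely, if [f] is monotone and differentiable, the derivative of [f[A + t J]]
    at [0], with [J] the all-ones matrix, is [f'[A]], so [f'] is positive. If [f] is
    convex and differentiable, the derivatives at the ends of a segment satisfy
    [f'[B] S C <= f'[B + C] S C]; when [C = v v^T] the factor [C] can be cancelled
    ([S_conv_derive_rank1]), and a general increment [A - B] is a sum of such [C].

    The core is that a monotone or convex [f] is differentiable, at negative points
    too. On [[0, alpha)] both kinds of functions are convex. A convex function has
    points [b], in any interval, where its difference quotients jump arbitrarily
    little ([slope_jump_small]). At an arbitrary [x], take [b] slightly above [|x|] and
    a test matrix with off-diagonal entries [x] and a diagonal entry [b]; a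
    Cauchy-Schwarz inequality for it bounds the square of the difference between two
    difference quotients at [x] by a constant times the jump at [b]
    ([S_mono3_slopes], [S_conv2_slopes]). So the quotients at [x] satisfy the Cauchy
    criterion. Two independent increments at [x] need two rows besides that of the
    constant factor, which is why monotonicity requires size 3; convexity
    compares two increments along one path already in size 2. *)

Local Open Scope classical_set_scope.
Local Open Scope ring_scope.

(** * Positive semidefinite matrices *)

Section PSD.
Context {R : realType}.

(** The quadratic form takes a plain function, so that test vectors can be
    written down coordinatewise. *)
Definition qform {n} (A : 'M[R]_n) (u : 'I_n -> R) : R :=
  \sum_i \sum_j A i j * (u i * u j).

Definition rank1 {n} (u : 'I_n -> R) : 'M[R]_n := \matrix_(i, j) (u i * u j).

Lemma psdP {n} (A : 'M[R]_n) :
  psdmx A <-> A^T = A /\ forall u, 0 <= qform A u.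
Proof.
have E (v : 'cV[R]_n) : (v^T *m A *m v) 0 0 = qform A (fun i => v i 0).
  rewrite /qform exchange_big mxE; apply: eq_bigr => j _.
  rewrite mxE mulr_suml; apply: eq_bigr => i _; rewrite !mxE; ring.
split=> -[As Aq]; split=> // u; last by rewrite E.
have := Aq (\col_i u i); rewrite E /qform.
by under eq_bigr do under eq_bigr do rewrite !mxE.
Qed.

Lemma psd_sym {n} {A : 'M[R]_n} i j : A^T = A -> A i j = A j i.
Proof. by move=> As; rewrite -{1}As mxE. Qed.

Lemma qformD {n} (A B : 'M[R]_n) u : qform (A + B) u = qform A u + qform B u.
Proof.
rewrite /qform -big_split; apply: eq_bigr => i _.
rewrite -big_split; apply: eq_bigr => j _; rewrite !mxE /=; ring.
Qed.

Lemma qformZ {n} a (A : 'M[R]_n) u : qform (a *: A) u = a * qform A u.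
Proof.
rewrite /qform mulr_sumr; apply: eq_bigr => i _.
rewrite mulr_sumr; apply: eq_bigr => j _; rewrite !mxE /=; ring.
Qed.

Lemma qformB {n} (A B : 'M[R]_n) u : qform (A - B) u = qform A u - qform B u.
Proof. by rewrite -scaleN1r qformD qformZ mulN1r. Qed.

Lemma qform_rank1 {n} (w u : 'I_n -> R) :
  qform (rank1 w) u = (\sum_i w i * u i) ^+ 2.
Proof.
rewrite expr2 mulr_suml; apply: eq_bigr => i _.
rewrite mulr_sumr; apply: eq_bigr => j _; rewrite !mxE; ring.
Qed.

Lemma psd_rank1 {n} (w : 'I_n -> R) : psdmx (rank1 w).
Proof.
apply/psdP; split; last by move=> u; rewrite qform_rank1 sqr_ge0.
by apply/matrixP => i j; rewrite !mxE mulrC.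
Qed.

Lemma psdD {n} {A B : 'M[R]_n} : psdmx A -> psdmx B -> psdmx (A + B).
Proof.
move=> /psdP[As Aq] /psdP[Bs Bq]; apply/psdP; split.
  by rewrite linearD /= As Bs.
by move=> u; rewrite qformD addr_ge0.
Qed.

Lemma psdZ {n} {a : R} {A : 'M[R]_n} : 0 <= a -> psdmx A -> psdmx (a *: A).
Proof.
move=> a0 /psdP[As Aq]; apply/psdP; split; first by rewrite linearZ /= As.
by move=> u; rewrite qformZ mulr_ge0.
Qed.

Lemma psd0 {n} : psdmx (0 : 'M[R]_n).
Proof.
rewrite (_ : 0 = 0 *: rank1 (fun=> 0)); last by rewrite scale0r.
exact/psdZ/psd_rank1.
Qed.

Lemma psd_const {n} {a : R} : 0 <= a -> psdmx (const_mx a : 'M[R]_n).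
Proof.
move=> a0; have -> : const_mx a = a *: rank1 (fun=> 1) :> 'M[R]_n.
  by apply/matrixP => i j; rewrite !mxE !mulr1.
exact/psdZ/psd_rank1.
Qed.

(** [mxsub g g A] is the congruence [P A P^T] by a 0-1 matrix [P], hence stays
    positive semidefinite even when [g] repeats indices. Repeating indices is
    what builds large test matrices out of 2 x 2 ones. *)
Lemma psd_mxsub {m n} (g : 'I_m -> 'I_n) {A : 'M[R]_n} :
  psdmx A -> psdmx (mxsub g g A).
Proof.
case=> As Aq; pose P := rowsub g 1%:M : 'M[R]_(m, n).
have -> : mxsub g g A = P *m A *m P^T.
  rewrite -mulmxA -rowsubE trmx_mxsub trmx1 mulmx_colsub mulmx1.
  by apply/matrixP => i j; rewrite !mxE.
split; first by rewrite !trmx_mul trmxK As mulmxA.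
by move=> v; have := Aq (P^T *m v); rewrite trmx_mul trmxK !mulmxA.
Qed.

Lemma psd_pair {n} {A : 'M[R]_n} i j (s t : R) : psdmx A ->
  0 <= s ^+ 2 * A i i + 2 * (s * t) * A i j + t ^+ 2 * A j j.
Proof.
move=> Ap; pose g (k : 'I_2) := if k == ord0 then i else j.
have [_ /(_ (fun k => if k == ord0 then s else t))] :=
  (psdP _).1 (psd_mxsub g Ap).
rewrite /qform !big_ord_recl !big_ord0 !mxE /= (psd_sym j i) ?Ap.1 //.
by move/le_trans; apply; rewrite le_eqVlt; apply/orP; left; apply/eqP; ring.
Qed.

Lemma psd_diag {n} {A : 'M[R]_n} i : psdmx A -> 0 <= A i i.
Proof.
by move=> Ap; have := psd_pair i i 1 0 Ap; rewrite !expr2; lra.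
Qed.

(** Because of this bound, a positive semidefinite matrix has all its entries in
    (-alpha, alpha) as soon as its diagonal does. *)
Lemma psd_entry {n} {A : 'M[R]_n} i j : psdmx A ->
  `|A i j| <= Num.max (A i i) (A j j).
Proof.
move=> Ap; have := psd_pair i j 1 1 Ap; have := psd_pair i j 1 (-1) Ap.
rewrite ler_norml le_max /Num.max !expr2; case: ltP; case: ltP; lra.
Qed.

Lemma psd_diag0 {n} {A : 'M[R]_n} :
  psdmx A -> (forall i, A i i = 0) -> A = 0.
Proof.
move=> Ap d0; apply/matrixP => i j; rewrite mxE.
by have := psd_entry i j Ap; rewrite !d0 maxxx normr_le0 => /eqP.
Qed.

(** Symmetric elimination: the value of the new form at [v] is the value of the
    old one at [v - t e_i0], where [t] completes the square along the axis
    [i0]. *)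
Lemma psd_pivot {n} {C : 'M[R]_n} {i0} : psdmx C -> 0 < C i0 i0 ->
  psdmx (C - rank1 (fun i => C i i0 / Num.sqrt (C i0 i0))).
Proof.
move=> /psdP[Cs Cq] c0; apply/psdP; split.
  rewrite linearB /= Cs; congr (_ - _); exact: (psd_rank1 _).1.
move=> v; rewrite qformB qform_rank1.
set c := C i0 i0 in c0 *; pose y := \sum_i C i i0 * v i.
have -> : \sum_i C i i0 / Num.sqrt c * v i = y / Num.sqrt c.
  rewrite mulr_suml; apply: eq_bigr => i _; ring.
rewrite expr_div_n sqr_sqrtr ?(ltW c0) //.
have := Cq (fun i => v i - y / c * (i == i0)%:R).
suff -> : qform C (fun i => v i - y / c * (i == i0)%:R) =
          qform C v - y ^+ 2 / c by [].
have yr i : \sum_j C i j * (v i * (y / c * (j == i0)%:R)) = y / c * (C i i0 * v i).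
  rewrite (bigD1 i0) //= eqxx /= ?mulr1 big1 ?addr0; first by ring.
  by move=> j /negPf->; rewrite !mulr0.
have yl j : \sum_i C i j * ((y / c * (i == i0)%:R) * v j) = y / c * (C j i0 * v j).
  rewrite (bigD1 i0) //= eqxx /= ?mulr1 big1 ?addr0; first by rewrite (psd_sym j i0) //; ring.
  by move=> i /negPf->; rewrite !(mulr0, mul0r).
have yy i : \sum_j C i j * ((y / c * (i == i0)%:R) * (y / c * (j == i0)%:R))
    = (y / c) ^+ 2 * C i i0 * (i == i0)%:R.
  rewrite (bigD1 i0) //= eqxx /= ?mulr1 big1 ?addr0; first by ring.
  by move=> j /negPf->; rewrite !mulr0.
have Er : y / c * y = \sum_i \sum_j C i j * (v i * (y / c * (j == i0)%:R)).
  by rewrite mulr_sumr; apply: eq_bigr => i _; rewrite yr.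
have El : y / c * y = \sum_i \sum_j C i j * ((y / c * (i == i0)%:R) * v j).
  by rewrite exchange_big mulr_sumr; apply: eq_bigr => i _; rewrite yl.
have Ey : (y / c) ^+ 2 * c =
    \sum_i \sum_j C i j * ((y / c * (i == i0)%:R) * (y / c * (j == i0)%:R)).
  under eq_bigr do rewrite yy; rewrite (bigD1 i0) //= eqxx /= mulr1 big1 ?addr0 //.
  by move=> j /negPf->; rewrite !mulr0.
transitivity (qform C v - (y / c) * y - (y / c) * y + (y / c) ^+ 2 * c); last first.
  by field; rewrite gt_eqF.
rewrite {1}Er El Ey.
rewrite /qform -!sumrB -big_split; apply: eq_bigr => i _ /=.
rewrite -!sumrB -big_split; apply: eq_bigr => j _ /=; ring.
Qed.

(** Each pivot kills one more diagonal entry, and a positive semidefinite matrix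
    with zero diagonal vanishes. *)
Lemma psd_sum_rank1 {n} {C : 'M[R]_n} : psdmx C ->
  exists s : seq ('I_n -> R), C = \sum_(u <- s) rank1 u.
Proof.
have [k] := ubnP #|[pred i | C i i != 0]|; elim: k C => // k IH C leCk Cp.
have [i0 /= Ci0|C0] := pickP [pred i | C i i != 0]; last first.
  exists [::]; rewrite big_nil; apply: psd_diag0 => // i.
  exact/eqP/negbFE/C0.
have c0 : 0 < C i0 i0 by rewrite lt_neqAle eq_sym Ci0 psd_diag.
have := psd_pivot Cp c0; set u := (u in rank1 u) => C'p.
have [|s Cs] := IH (C - rank1 u) _ C'p.
  rewrite -ltnS (leq_trans _ leCk) // ltnS; apply/proper_card/properP; split.
    apply/fintype.subsetP => i; rewrite !inE; apply: contra_neq => Ci.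
    apply/eqP; rewrite eq_le psd_diag // andbT !mxE Ci sub0r oppr_le0 -expr2.
    exact: sqr_ge0.
  exists i0; rewrite !inE // !mxE negbK subr_eq0 /u mulf_div -!expr2 sqr_sqrtr ?ltW //.
  by rewrite expr2 mulfK.
by exists (u :: s); rewrite big_cons -Cs addrC subrK.
Qed.

Lemma psd_sum {n} (I : Type) (s : seq I) (F : I -> 'M[R]_n) :
  (forall i, psdmx (F i)) -> psdmx (\sum_(i <- s) F i).
Proof. by move=> Fp; elim/big_ind: _ => // [|? ? ? ?]; [exact: psd0|exact: psdD]. Qed.

Definition hadamard {n} (A B : 'M[R]_n) : 'M[R]_n := \matrix_(i, j) (A i j * B i j).

(** Schur product theorem. By the rank-one decomposition of [B] it is enough to
    treat [B = w w^T], where the form of the product at [u] is the form of [A] at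
    the entrywise product of [w] and [u]. *)
Lemma psd_hadamard {n} {A B : 'M[R]_n} :
  psdmx A -> psdmx B -> psdmx (hadamard A B).
Proof.
move=> /psdP[As Aq] /[dup] Bp /psd_sum_rank1[s Bs].
have -> : hadamard A B = \sum_(w <- s) hadamard A (rank1 w).
  apply/matrixP => i j; rewrite mxE Bs !summxE mulr_sumr.
  by apply: eq_bigr => w _; rewrite !mxE.
apply: psd_sum => w; apply/psdP; split.
  by apply/matrixP => i j; rewrite !mxE (psd_sym i j) // mulrC (mulrC (w j)) mulrC.
move=> u; have := Aq (fun i => w i * u i); congr (0 <= _).
by apply: eq_bigr => i _; apply: eq_bigr => j _; rewrite !mxE; ring.
Qed.

Definition mx2 (p x q : R) : 'M[R]_2 :=
  \matrix_(i, j) if i == j then (if i == ord0 then p else q) else x.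

(** Diagonal dominance. *)
Lemma psd_mx2 {p x q : R} : `|x| <= p -> `|x| <= q -> psdmx (mx2 p x q).
Proof.
rewrite !ler_norml => /andP[xp px] /andP[xq qx].
apply/psdP; split.
  by apply/matrixP => i j; rewrite !mxE eq_sym; case: eqP => // ->.
move=> u; rewrite /qform !big_ord_recl !big_ord0 !mxE /=.
set a := u _; set b := u _.
suff H : 0 <= p * a ^+ 2 + 2 * x * (a * b) + q * b ^+ 2.
  by rewrite !expr2 in H; lra.
have := sqr_ge0 a; have := sqr_ge0 b; have := sqr_ge0 (a + b).
have := sqr_ge0 (a - b); rewrite !expr2; case: (lerP 0 x) => x0; nra.
Qed.

(** The test vectors [(q, -p)] and [(-r, q)] settle the cases [p > 0] and [r > 0];
    if [p = r = 0] the form is [2 s t q], which forces [q = 0]. *)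
Lemma quad_discr {p q r : R} : (forall s t : R, 0 <= s ^+ 2 * p + 2 * (s * t) * q + t ^+ 2 * r) ->
  q ^+ 2 <= p * r.
Proof.
move=> H; have p0 := H 1 0; have r0 := H 0 1.
have := H q (- p); have := H (- r) q; have := H 1 (- q); rewrite !expr2 in p0 r0 *.
move=> H1 H2 H3.
have {}p0 : 0 <= p by lra.
have {}r0 : 0 <= r by lra.
have [pp|] := ltP 0 p.
  have : 0 <= p * (p * r - q * q) by lra.
  by rewrite pmulr_rge0 // subr_ge0.
have [rp|] := ltP 0 r.
  have : 0 <= r * (p * r - q * q) by lra.
  by rewrite pmulr_rge0 // subr_ge0.
move=> r1 p1; have Er : r = 0 by lra.
have Ep : p = 0 by lra.
by move: H1; rewrite Er Ep; lra.
Qed.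

End PSD.

(** * Matrices with entries in a symmetric interval *)

Section Domain.
Context {R : realType} {alpha : \bar R}.

Lemma sym_itvE x : sym_itv alpha x <-> (`|x|%:E < alpha)%E.
Proof.
rewrite /sym_itv /=; case: alpha => [a| |] //=.
- by rewrite !lte_fin ltr_norml.
- by rewrite ltNyr !ltry.
Qed.

Lemma sym_itv_le {x y : R} : `|y| <= x -> sym_itv alpha x -> sym_itv alpha y.
Proof.
rewrite !sym_itvE => yx; apply: le_lt_trans; rewrite lee_fin.
exact/(le_trans yx)/ler_norm.
Qed.

Lemma sym_itv_room {x : R} : sym_itv alpha x ->
  exists2 r : R, 0 < r & sym_itv alpha (`|x| + r).
Proof.
move=> /sym_itvE xa.
suff [r r0 xr] : exists2 r : R, 0 < r & ((`|x| + r)%:E < alpha)%E.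
  by exists r => //; rewrite sym_itvE ger0_norm // addr_ge0 ?normr_ge0 ?ltW.
move: xa; case: alpha => [a| |] //=; last by exists 1; rewrite ?ltry.
by rewrite lte_fin => xa; exists ((a - `|x|) / 2); rewrite ?lte_fin; lra.
Qed.

Lemma psd_entries_in {n} {A : 'M[R]_n} : psdmx A ->
  (forall i, sym_itv alpha (A i i)) -> entries_in (sym_itv alpha) A.
Proof.
move=> Ap Ad i j; have := psd_entry i j Ap.
by rewrite /Num.max; case: ifP => _ /sym_itv_le; apply.
Qed.

Lemma entries_in_summand {n} {A C : 'M[R]_n} : psdmx A -> psdmx C ->
  entries_in (sym_itv alpha) (A + C) -> entries_in (sym_itv alpha) A.
Proof.
move=> Ap Cp ACd; apply: psd_entries_in => // i; apply: sym_itv_le (ACd i i).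
by rewrite ger0_norm ?psd_diag // mxE lerDl psd_diag.
Qed.

Lemma entries_in_room {n} {A : 'M[R]_n} : (0 < alpha)%E ->
  entries_in (sym_itv alpha) A ->
  exists2 r : R, 0 < r & forall t : R, `|t| <= r -> entries_in (sym_itv alpha) (A + const_mx t).
Proof.
move=> a0 Ad.
have [m m0 [md Am]] : exists2 m : R, 0 <= m &
    sym_itv alpha m /\ forall i j, `|A i j| <= m.
  pose m := \big[Num.max/0]_(p : 'I_n * 'I_n) `|A p.1 p.2|.
  exists m; first exact: bigmax_ge_id.
  split; last by move=> i j; exact: (le_bigmax _ (fun p => `|A p.1 p.2|) (i, j)).
  rewrite /m; elim/big_ind: _ => [|x y|[i j] _].
  - by rewrite sym_itvE normr0.
  - by rewrite /Num.max; case: ifP.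
  - by apply/sym_itvE; rewrite normr_id; exact/sym_itvE.
have [r r0 rd] := sym_itv_room md; exists r => // t tr i j; rewrite !mxE.
apply: sym_itv_le rd; rewrite (le_trans (ler_normD _ _)) // lerD //.
exact/(le_trans (Am _ _))/ler_norm.
Qed.

Lemma entries_in_mxsub {m n} (g : 'I_m -> 'I_n) {A : 'M[R]_n} :
  entries_in (sym_itv alpha) A -> entries_in (sym_itv alpha) (mxsub g g A).
Proof. by move=> Ad i j; rewrite mxE. Qed.

Lemma entries_in_segment {n} {A B : 'M[R]_n} {t : R} : 0 <= t <= 1 ->
  entries_in (sym_itv alpha) A -> entries_in (sym_itv alpha) B ->
  entries_in (sym_itv alpha) (B + t *: (A - B)).
Proof.
move=> /andP[t0 t1] Ad Bd i j; move: (Ad i j) (Bd i j); rewrite !mxE.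
set a := A i j; set b := B i j => da db.
have cvx m : `|a| <= m -> `|b| <= m -> `|b + t * (a - b)| <= m.
  by rewrite !ler_norml => /andP[? ?] /andP[? ?]; apply/andP; split; nra.
have [ab|/ltW ab] := leP `|a| `|b|.
  by apply: sym_itv_le (cvx _ ab (lexx _)) _; apply/sym_itvE; rewrite normr_id -sym_itvE.
by apply: sym_itv_le (cvx _ (lexx _) ab) _; apply/sym_itvE; rewrite normr_id -sym_itvE.
Qed.

Lemma mxsub_section {m n} (h : 'I_m -> 'I_n) (g : 'I_n -> 'I_m) (A : 'M[R]_m) :
  cancel h g -> mxsub h h (mxsub g g A) = A.
Proof. by move=> hK; apply/matrixP => i j; rewrite !mxE !hK. Qed.

Lemma ord_retraction {m n} : (m < n)%N ->
  exists (h : 'I_m.+1 -> 'I_n) (g : 'I_n -> 'I_m.+1), cancel h g.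
Proof.
move=> mn; exists (widen_ord mn), (fun i => inord i) => i.
by apply: val_inj; rewrite /= inordK.
Qed.

(** The classes shrink as the size grows: a matrix of size [m.+1] is blown up to
    size [n] by repeating indices, and recovered as a submatrix. *)
Lemma S_mono_smaller {m n} {f : R -> R} : (m < n)%N ->
  S_mono n alpha f -> S_mono m.+1 alpha f.
Proof.
move=> /ord_retraction[h [g hK]] Hf A B As Bs Ad Bd AB Bp.
have sub (C : 'M[R]_m.+1) : C^T = C -> (mxsub g g C)^T = mxsub g g C.
  by move=> Cs; rewrite trmx_mxsub Cs.
have := Hf _ _ (sub _ As) (sub _ Bs) (entries_in_mxsub g Ad) (entries_in_mxsub g Bd).
rewrite /loewner_le -linearB => /(_ (psd_mxsub g AB) (psd_mxsub g Bp)).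
by move=> /(psd_mxsub h); rewrite linearB /= -!map_mxsub !mxsub_section.
Qed.

Lemma S_conv_smaller {m n} {f : R -> R} : (m < n)%N ->
  S_conv n alpha f -> S_conv m.+1 alpha f.
Proof.
move=> /ord_retraction[h [g hK]] Hf A B As Bs Ad Bd AB Bp l l01.
have sub (C : 'M[R]_m.+1) : C^T = C -> (mxsub g g C)^T = mxsub g g C.
  by move=> Cs; rewrite trmx_mxsub Cs.
have := Hf _ _ (sub _ As) (sub _ Bs) (entries_in_mxsub g Ad) (entries_in_mxsub g Bd).
rewrite /loewner_le -linearB => /(_ (psd_mxsub g AB) (psd_mxsub g Bp) l l01).
move=> /(psd_mxsub h).
by rewrite linearB linearD !linearZ /= -!map_mxsub linearD !linearZ /= !mxsub_section.
Qed.

Lemma map_mx_sym {n} (f : R -> R) (A : 'M[R]_n) : A^T = A -> (map_mx f A)^T = map_mx f A.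
Proof. by move=> As; rewrite map_trmx As. Qed.

End Domain.

(** * Difference quotients *)

Section Slopes.
Context {R : realType}.
Implicit Types (f : R -> R) (D : set R).

Definition slope f (x h : R) : R := (f (x + h) - f x) / h.

(** Convexity on an interval, in the cross-multiplied form of the three-chord
    inequality. *)
Definition chord_convex D f := forall a b c : R, D a -> D c -> a < b -> b < c ->
  (f b - f a) * (c - b) <= (f c - f b) * (b - a).

Lemma slopeN f x h : slope f (x + h) (- h) = slope f x h.
Proof. by rewrite /slope addrK invrN mulrN -mulNr opprB. Qed.

Lemma slope_mono {D f} {x h k : R} : chord_convex D f ->
  D x -> D (x + h) -> D (x + k) -> h != 0 -> k != 0 -> h <= k ->
  slope f x h <= slope f x k.
Proof.
move=> Cf dx dh dk h0 k0; rewrite le_eqVlt => /predU1P[->//|hk].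
have [h1|h1|h1] := ltgtP h 0; last by rewrite h1 eqxx in h0.
- have [k1|k1|k1] := ltgtP k 0; last by rewrite k1 eqxx in k0.
  + have H := Cf (x + h) (x + k) x dh dx ltac:(lra) ltac:(lra).
    rewrite /slope ler_ndivrMr // mulrAC ler_ndivrMr //; lra.
  + have H := Cf (x + h) x (x + k) dh dk ltac:(lra) ltac:(lra).
    rewrite /slope ler_ndivrMr // mulrAC ler_pdivrMr //; lra.
- have k1 : 0 < k by lra.
  have H := Cf x (x + h) (x + k) dx dk ltac:(lra) ltac:(lra).
  rewrite /slope ler_pdivrMr // mulrAC ler_pdivlMr //; lra.
Qed.

(** A convex function is almost differentiable somewhere. On a grid of step [rho]
    in [[p, q]] the left quotient at a point is the right quotient at the previous
    point, so the jumps of the quotient telescope: their sum is at most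
    [slope f q (q0 - q) - slope f p (p0 - p)], however fine the grid is. With enough
    points one of the jumps is small. *)
Lemma slope_jump_small {D f} {p0 p q q0 e : R} : chord_convex D f ->
  p0 < p -> p < q -> q < q0 -> (forall x : R, p0 <= x <= q0 -> D x) -> 0 < e ->
  exists b rho : R, [/\ 0 < rho, p <= b - rho, b + rho <= q &
    slope f b rho - slope f b (- rho) < e].
Proof.
move=> Cf p0p pq qq0 pqD e0; apply: contrapT => nex.
have {}nex (b rho : R) : 0 < rho -> p <= b - rho -> b + rho <= q ->
    slope f b (- rho) + e <= slope f b rho.
  move=> r0 pb bq; rewrite leNgt; apply/negP => lt; apply: nex; exists b, rho.
  by split=> //; rewrite ltrBlDl.
pose C0 : R := slope f p (p0 - p); pose C1 : R := slope f q (q0 - q).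
pose N := Num.Def.archi_bound `|(C1 - C0) / e|.
have NC : C1 - C0 < N%:R * e.
  rewrite -ltr_pdivrMr //; apply: (le_lt_trans (ler_norm _)).
  exact/archi_boundP/normr_ge0.
pose rho : R := (q - p) / N.+1%:R.
have N0 : 0 < N.+1%:R :> R by rewrite ltr0n.
have rho0 : 0 < rho by rewrite divr_gt0 // subr_gt0.
have rhoN : N.+1%:R * rho = q - p by rewrite mulrC divfK // gt_eqF.
have rhoq : rho <= q - p by rewrite -rhoN ler_peMl ?ler1n // ltW.
have step k : (k <= N)%N -> C0 + k%:R * e <= slope f (p + k%:R * rho) rho.
  elim: k => [|k IH] kN.
    rewrite !mul0r !addr0; apply: slope_mono Cf _ _ _ _ _ _; try (apply: pqD); try lra.
  have /IH{}IH := ltnW kN.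
  have := nex (p + k.+1%:R * rho) rho rho0.
  have kN' : k.+2%:R * rho <= q - p by rewrite -rhoN ler_pM2r // ler_nat.
  have k0 : 0 <= k%:R * rho by rewrite mulr_ge0 // ltW.
  (* the left quotient at the grid point k+1 is the right quotient at k *)
  move: kN' IH; rewrite -!natr1 !mulrDl !mul1r => kN' IH.
  have -> : p + (k%:R * rho + rho) = p + k%:R * rho + rho by ring.
  rewrite slopeN; lra.
have := step N (leqnn N).
have -> : p + N%:R * rho = q - rho.
  by move: rhoN; rewrite -natr1 mulrDl mul1r; lra.
rewrite -slopeN subrK.
have : slope f q (- rho) <= C1.
  by apply: slope_mono Cf _ _ _ _ _ _; try (apply: pqD); lra.
lra.
Qed.

(** Cauchy criterion for differentiability. *)
Lemma slope_cauchy_derivable {f x} :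
  (forall e : R, 0 < e -> exists2 d : R, 0 < d & forall h k : R, h != 0 -> k != 0 ->
    `|h| <= d -> `|k| <= d -> (slope f x h - slope f x k) ^+ 2 < e) ->
  derivable f x 1.
Proof.
move=> H; apply/cauchy_cvgP/cauchy_ballP => e e0.
have [d d0 Hd] := H _ (exprn_gt0 2 e0).
have near_d : \forall h \near (0 : R)^', h != 0 /\ `|h| <= d.
  near=> h; split; first by near: h; exact: nbhs_dnbhs_neq.
  near: h; exact: dnbhs0_le.
exists ((fun h => h^-1 *: ((f \o shift x) (h *: 1) - f x)) @` [set h | h != 0 /\ `|h| <= d],
  (fun h => h^-1 *: ((f \o shift x) (h *: 1) - f x)) @` [set h | h != 0 /\ `|h| <= d]).
  by split; apply: filterS near_d => h hd; exists h.
move=> [_ _] [[h [h0 hd] <-] [k [k0 kd] <-]].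
have := Hd h k h0 k0 hd kd.
rewrite /ball /= -ltr_sqrt ?exprn_gt0// sqrtr_sqr sqrtr_sqr (gtr0_norm e0).
by rewrite /slope /GRing.scale /= !mulr1 ![_^-1 * _]mulrC ![_ + x]addrC.
Unshelve. all: by end_near. Qed.

Lemma is_derive_slope {f} {x d : R} : is_derive x 1 f d ->
  forall e : R, 0 < e -> exists2 r : R, 0 < r & forall h : R, h != 0 -> `|h| < r ->
    `|d - slope f x h| < e.
Proof.
case=> fx <- e e0; have /cvgrPdist_lt/(_ e e0) := fx.
move=> /nbhs_ballP[r /= r0 Hr]; exists r => // h h0 hr.
have := Hr h; rewrite /ball /= sub0r normrN => /(_ hr h0).
by rewrite /slope /GRing.scale /= !mulr1 ![_^-1 * _]mulrC ![_ + x]addrC.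
Qed.

(** The sign [s] selects the side from which the derivative is approached. *)
Lemma slope_approx {f} {x d e : R} (r s : R) : is_derive x 1 f d -> 0 < r -> 0 < e ->
  `|s| = 1 -> exists2 h : R, 0 < h < r & `|d - slope f x (s * h)| < e.
Proof.
move=> fd r0 e0 s1; have [q q0 Hq] := is_derive_slope fd _ e0.
pose h := Num.min r q / 2.
have h0 : 0 < h by rewrite divr_gt0 // lt_min r0 q0.
have [hr hq] : h < r /\ h < q.
  have : Num.min r q <= r by rewrite ge_min lexx.
  have : Num.min r q <= q by rewrite ge_min lexx orbT.
  by move: h0; rewrite /h; lra.
exists h; first by rewrite h0 hr.
apply: Hq; last by rewrite normrM s1 mul1r gtr0_norm.
by rewrite mulf_neq0 ?(gt_eqF h0) // -normr_eq0 s1 oner_eq0.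
Qed.

Lemma slope_le_derive {f} {x d c : R} (r : R) : 0 < r -> is_derive x 1 f d ->
  (forall h : R, 0 < h < r -> c <= slope f x h) -> c <= d.
Proof.
move=> r0 fd H; rewrite leNgt; apply/negP; rewrite -subr_gt0 => dc.
have [h /H + ] := slope_approx r 1 fd r0 dc (normr1 _).
by rewrite mul1r ltr_norml; lra.
Qed.

Lemma derive_le_slope {f} {x d c : R} (r : R) : 0 < r -> is_derive x 1 f d ->
  (forall h : R, 0 < h < r -> slope f x h <= c) -> d <= c.
Proof.
move=> r0 fd H; rewrite leNgt; apply/negP; rewrite -subr_gt0 => dc.
have [h /H + ] := slope_approx r 1 fd r0 dc (normr1 _).
by rewrite mul1r ltr_norml; lra.
Qed.

Lemma slope_left_le_derive {f} {x d c : R} (r : R) : 0 < r -> is_derive x 1 f d ->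
  (forall h : R, 0 < h < r -> c <= slope f x (- h)) -> c <= d.
Proof.
move=> r0 fd H; rewrite leNgt; apply/negP; rewrite -subr_gt0 => dc.
have [h /H + ] := slope_approx r (- 1) fd r0 dc (normrN1 _).
by rewrite mulN1r ltr_norml; lra.
Qed.

Lemma derive_mvt {f df : R -> R} {a b : R} : a < b ->
  (forall x : R, a <= x <= b -> is_derive x 1 f (df x)) ->
  exists c : R, a < c < b /\ f b - f a = df c * (b - a).
Proof.
move=> ab Hf; have [||c cab E] := @MVT R f df a b ab.
- by move=> x; rewrite in_itv /= => /andP[? ?]; apply: Hf; rewrite !ltW.
- apply: derivable_within_continuous => x; rewrite in_itv /= => /Hf H.
  by case: H.
by exists c; move: cab; rewrite in_itv.
Qed.

(** The mean value theorem on [[0, l]] and on [[l, 1]]. *)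
Lemma derive_mono_convex {f df : R -> R} {l : R} : 0 <= l <= 1 ->
  (forall x : R, 0 <= x <= 1 -> is_derive x 1 f (df x)) ->
  (forall x y : R, 0 <= x -> x <= y -> y <= 1 -> df x <= df y) ->
  f l <= l * f 1 + (1 - l) * f 0.
Proof.
rewrite le_eqVlt => /andP[/predU1P[<- _|l0]].
  by rewrite mul0r add0r subr0 mul1r.
rewrite le_eqVlt => /predU1P[->|l1]; first by rewrite subrr mul0r addr0 mul1r.
move=> Hf mono.
have [|c [/andP[c0 c1] Ec]] := derive_mvt l0 (df := df) (f := f).
  by move=> x xl; apply: Hf; lra.
have [|d [/andP[d0 d1] Ed]] := derive_mvt l1 (df := df) (f := f).
  by move=> x xl; apply: Hf; lra.
have cd : df c <= df d by apply: mono; lra.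
have : (1 - l) * l * df c <= (1 - l) * l * df d.
  by rewrite ler_wpM2l // mulr_ge0 //; lra.
have -> : (1 - l) * l * df c = (1 - l) * (f l - f 0) by rewrite Ec; ring.
have -> : (1 - l) * l * df d = l * (f 1 - f l) by rewrite Ed; ring.
lra.
Qed.

End Slopes.

(** * Differentiability of entrywise monotone functions *)

Section MonoDerivable.
Context {R : realType} {alpha : \bar R}.
Implicit Types f : R -> R.

Definition nneg_itv : set R := [set x | 0 <= x /\ sym_itv alpha x].

Lemma nneg_itv_le {x y : R} : nneg_itv y -> 0 <= x -> x <= y -> nneg_itv x.
Proof. by move=> [_ dy] x0 xy; split => //; apply: sym_itv_le dy; rewrite ger0_norm. Qed.

Lemma S_mono_add {n f} {A C : 'M[R]_n} : S_mono n alpha f ->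
  psdmx A -> psdmx C -> (forall i, sym_itv alpha ((A + C) i i)) ->
  psdmx (map_mx f (A + C) - map_mx f A).
Proof.
move=> Hf Ap Cp ACd; have ACp := psdD Ap Cp.
have ACe := psd_entries_in ACp ACd.
apply: Hf => //; [exact: ACp.1|exact: Ap.1|exact: entries_in_summand ACe|].
by rewrite /loewner_le addrAC subrr add0r.
Qed.

(** Compare [[[b, a], [a, a]]] with its translate by [t] in every entry, and test
    the difference on [(1, -1)]. *)
Lemma S_mono2_incr {f} {a b t : R} : S_mono 2 alpha f ->
  0 <= a -> a <= b -> 0 <= t -> sym_itv alpha (b + t) ->
  0 <= f (a + t) - f a <= f (b + t) - f b.
Proof.
move=> Hf a0 ab t0 bd.
have Ap : psdmx (mx2 b a a) by apply: psd_mx2; rewrite ger0_norm.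
have := S_mono_add Hf Ap (psd_const t0); case.
  move=> i; rewrite !mxE eqxx; case: ifP => // _; apply: sym_itv_le bd.
  by rewrite ger0_norm ?addr_ge0 // lerD2r.
move=> M1 M2; have Mp := conj M1 M2 : psdmx _.
have := psd_diag ord_max Mp; have := psd_pair ord0 ord_max 1 (- 1) Mp.
rewrite !mxE /= !expr2; lra.
Qed.

(** If all increments of [f] are nonnegative and nondecreasing on the half interval,
    then [f] is convex there. Divide [[a, b]] into [n] steps of length [h]: each of
    them increases [f] by at most [G = f (b + h) - f b], whereas the [m] steps of
    length [h] that fit in [[b, c]] increase it by at least [G]. Hence
    [(f b - f a) m <= n m G <= (f c - f b) n], and [m / n] tends to
    [(c - b) / (b - a)]. *)
Lemma wright_chord_convex {f} :
  (forall a b t : R, 0 <= a -> a <= b -> 0 <= t -> sym_itv alpha (b + t) ->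
    0 <= f (a + t) - f a <= f (b + t) - f b) ->
  chord_convex nneg_itv f.
Proof.
move=> W a b c da dc ab bc; have a0 := da.1.
have D (y : R) : 0 <= y -> y <= c -> sym_itv alpha y by move=> *; apply: (nneg_itv_le dc _ _).2.
have X0 : 0 <= f b - f a.
  have := W a a (b - a); rewrite subrKC => /(_ a0 (lexx _)).
  by case/(_ _ _)/andP=> //; [lra|apply: D; lra].
have Y0 : 0 <= f c - f b.
  have := W b b (c - b); rewrite subrKC.
  by case/(_ _ _ _ _)/andP=> //; [lra|lra|apply: D; lra].
set X := f b - f a in X0 *; set Y := f c - f b in Y0 *.
rewrite leNgt; apply/negP => YX.
pose u : R := b - a; pose v : R := c - b; have u0 : 0 < u by rewrite subr_gt0.
have v0 : 0 < v by rewrite subr_gt0.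
have {YX}gap : 0 < X * v - Y * u by rewrite subr_gt0.
(* with this n the rounding error X h is smaller than the assumed gap *)
pose n := (Num.Def.archi_bound `|X * u / (X * v - Y * u)|).+1.
have n0 : 0 < n%:R :> R by rewrite ltr0n.
have nb : X * u < n%:R * (X * v - Y * u).
  rewrite -ltr_pdivrMr //; apply: (le_lt_trans (ler_norm _)).
  apply: lt_trans (archi_boundP (normr_ge0 _)) _.
  by rewrite ltr_nat.
pose h : R := u / n%:R; have h0 : 0 < h by rewrite divr_gt0.
have nh : n%:R * h = u by rewrite mulrC divfK // gt_eqF.
pose m := Num.truncn (v / h).
have /andP[mv vm] : m%:R * h <= v < m.+1%:R * h.
  rewrite -ler_pdivlMr // -ltr_pdivrMr //.
  by apply: truncn_itv; rewrite divr_ge0 // ltW.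
have XY : X * m%:R <= Y * n%:R.
  have [->|m0] := posnP m; first by rewrite mulr0 mulr_ge0 // ltW.
  have hv : h <= v by apply: le_trans mv; rewrite ler_peMl ?ler1n // ltW.
  pose G := f (b + h) - f b.
  have bhd : sym_itv alpha (b + h) by apply: D; rewrite /v in hv; lra.
  have up k : (k <= n)%N -> f (a + k%:R * h) - f a <= k%:R * G.
    elim: k => [|k IH] kn; first by rewrite !mul0r addr0 subrr.
    have {}IH := IH (ltnW kn).
    have kb : a + k%:R * h <= b.
      by rewrite -lerBrDl -/u -nh ler_pM2r // ler_nat ltnW.
    have k0 : 0 <= k%:R * h by rewrite mulr_ge0 // ltW.
    have /andP[_] := W (a + k%:R * h) b h (addr_ge0 a0 k0) kb (ltW h0) bhd.
    rewrite -natr1 !mulrDl !mul1r addrA -/G. move=> inc.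
    by apply: le_trans (lerD IH inc); rewrite [leRHS]addrC subrKA.
  have dn k : (k <= m)%N -> k%:R * G <= f (b + k%:R * h) - f b.
    elim: k => [|k IH] km; first by rewrite !mul0r addr0 subrr.
    have {}IH := IH (ltnW km).
    have kb : k.+1%:R * h <= v by apply: le_trans mv; rewrite ler_pM2r // ler_nat.
    have k0 : 0 <= k%:R * h by rewrite mulr_ge0 // ltW.
    rewrite -natr1 mulrDl mul1r in kb.
    have bkd : sym_itv alpha (b + k%:R * h + h) by apply: D; rewrite /v in kb; lra.
    have /andP[_] := W b (b + k%:R * h) h ltac:(lra) ltac:(lra) (ltW h0) bkd.
    rewrite -/G => inc.
    rewrite -natr1 [in leLHS]mulrDl mul1r [in leRHS]mulrDl mul1r (addrA b); lra.
  have := up n (leqnn n); rewrite nh /u subrKC -/X => XG.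
  have := dn m (leqnn m) => GY.
  have mh0 : 0 <= m%:R * h by rewrite mulr_ge0 // ltW.
  have /andP[mc _] := W (b + m%:R * h) (b + m%:R * h) (c - (b + m%:R * h))
    ltac:(lra) (lexx _) ltac:(rewrite /v in mv; lra) ltac:(rewrite subrKC; exact: dc.2).
  have {mc}GY : m%:R * G <= Y by move: mc; rewrite subrKC /Y; lra.
  apply: (@le_trans _ _ (n%:R * G * m%:R)); first by rewrite ler_wpM2r.
  by rewrite -mulrA mulrC ler_wpM2r // mulrC.
have X1 : 0 < X by rewrite lt_neqAle X0 andbT; apply/eqP => X1; move: gap;
  rewrite -X1 mul0r sub0r oppr_gt0 => /lt_geF; rewrite mulr_ge0 // ltW.
have : X * (v - h) < Y * u.
  apply: (@lt_le_trans _ _ (X * (m%:R * h))).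
    by rewrite ltr_pM2l // ltrBlDr; move: vm; rewrite -natr1 mulrDl mul1r.
  have -> : Y * u = Y * n%:R * h by rewrite -mulrA nh.
  by rewrite mulrA ler_pM2r.
have : X * h < X * v - Y * u by rewrite /h mulrA ltr_pdivrMr // [ltRHS]mulrC.
lra.
Qed.

(** This is where size 3 is needed. Let [A] have the rows [(q, x, x)], [(x, b, b)],
    [(x, b, b)], and add the rank-one matrix of [(w, ep, de)]. On the test vectors
    [(s, t / ep, - t / de)] the cross term is the difference of two quotients at
    [x], for two unrelated increments, while the coefficient of [t ^ 2] only involves
    quotients at [b]. The point [x] may be negative, but [q] and [b] are not. *)
Lemma S_mono3_slopes {f} {x b q w ep de : R} : S_mono 3 alpha f ->
  `|x| <= q -> `|x| <= b -> w != 0 -> ep != 0 -> de != 0 ->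
  sym_itv alpha (q + w ^+ 2) -> sym_itv alpha (b + ep ^+ 2) ->
  sym_itv alpha (b + de ^+ 2) ->
  (w * (slope f x (w * ep) - slope f x (w * de))) ^+ 2 <=
  (f (q + w ^+ 2) - f q) *
  (slope f b (ep ^+ 2) - 2 * slope f b (ep * de) + slope f b (de ^+ 2)).
Proof.
move=> Hf xq xb w0 ep0 de0 qd epd ded.
pose g (i : 'I_3) : 'I_2 := if i == ord0 then ord0 else ord_max.
pose z (i : 'I_3) : R := nth 0 [:: w; ep; de] i.
have Cd i : sym_itv alpha ((mxsub g g (mx2 q x b) + rank1 z) i i).
  by case: i => [[|[|[|i]]]] // i3; rewrite !mxE /= -expr2.
have /psdP[_ Mp] :=
  S_mono_add Hf (psd_mxsub g (psd_mx2 xq xb)) (psd_rank1 z) Cd.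
apply: quad_discr => s t.
have := Mp (fun i => nth 0 [:: s; t / ep; - (t / de)] i).
rewrite /qform !big_ord_recl !big_ord0 !mxE /= /slope.
rewrite -!expr2 ![_ * w]mulrC [de * ep]mulrC.
congr (0 <= _); field; by rewrite w0 ep0 de0.
Qed.

(** Differentiability at [x], of either sign, is transferred from the positive half
    line: it is enough that the oscillation of the quotients at [x] is controlled by
    the jump of the quotients at an arbitrary point [b] slightly above [|x|], because
    that point may be chosen with a small jump. *)
Lemma small_jumps_derivable {f} {x d K : R} :
  chord_convex nneg_itv f -> 0 < d -> sym_itv alpha (`|x| + 3 * d) -> 0 <= K ->
  (forall b rho : R, 0 < rho -> `|x| + d <= b - rho -> b + rho <= `|x| + 2 * d ->
    forall h k : R, h != 0 -> k != 0 ->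
      `|h| <= Num.sqrt d * Num.sqrt rho -> `|k| <= Num.sqrt d * Num.sqrt rho ->
      (slope f x h - slope f x k) ^+ 2 <=
      K * (slope f b rho - slope f b (- rho))) ->
  derivable f x 1.
Proof.
move=> Cf d0 xd K0 H; apply: slope_cauchy_derivable => e e0.
have x0 := normr_ge0 x.
have D (y : R) : `|x| <= y <= `|x| + 3 * d -> nneg_itv y.
  by move=> yx; apply: (@nneg_itv_le _ (`|x| + 3 * d)); [split=> //|..]; lra.
have e1 : 0 < e / (K + 1) by rewrite divr_gt0 //; lra.
have xp : `|x| < `|x| + d by lra.
have pq : `|x| + d < `|x| + 2 * d by lra.
have qq0 : `|x| + 2 * d < `|x| + 3 * d by lra.
have [b [rho [rho0 pb bq jump]]] := slope_jump_small Cf xp pq qq0 D e1.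
exists (Num.sqrt d * Num.sqrt rho) => [|h k h0 k0 hr kr].
  by rewrite mulr_gt0 // sqrtr_gt0.
apply: le_lt_trans (H b rho rho0 pb bq h k h0 k0 hr kr) _.
apply: (@le_lt_trans _ _ (K * (e / (K + 1)))); first by rewrite ler_wpM2l // ltW.
by rewrite mulrA ltr_pdivrMr; lra.
Qed.

Lemma S_mono3_derivable {f x} : S_mono 3 alpha f -> sym_itv alpha x -> derivable f x 1.
Proof.
move=> Hf /sym_itv_room[r r0 xr].
have Hf2 : S_mono 2 alpha f by exact: S_mono_smaller Hf.
have W a b t := @S_mono2_incr f a b t Hf2.
have Cf := wright_chord_convex W.
pose d : R := r / 3; have d0 : 0 < d by rewrite divr_gt0.
have x0 := normr_ge0 x.
have xd : sym_itv alpha (`|x| + 3 * d) by rewrite /d mulrC divfK.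
have D (y : R) : `|x| <= y <= `|x| + 3 * d -> nneg_itv y.
  by move=> yx; apply: (@nneg_itv_le _ (`|x| + 3 * d)); [split=> //|..]; lra.
pose q : R := `|x| + 2 * d.
have qd : sym_itv alpha (q + d) by apply: (D _ _).2; rewrite /q; lra.
pose K := f (q + d) - f q.
have K0 : 0 <= K.
  have qp : 0 <= q by rewrite /q; lra.
  by have /andP[] := W q q d qp (lexx _) (ltW d0) qd.
apply: (small_jumps_derivable (K := 2 * K / d) Cf d0 xd).
  by rewrite divr_ge0 ?mulr_ge0 // ltW.
move=> b rho rho0 pb bq h k h0 k0 hr kr.
pose w : R := Num.sqrt d; have w0 : 0 < w by rewrite sqrtr_gt0.
have w2 : w ^+ 2 = d by rewrite sqr_sqrtr // ltW.
have red (y : R) : y != 0 -> `|y| <= w * Num.sqrt rho -> exists z : R,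
    [/\ y = w * z, z != 0 & `|z| <= Num.sqrt rho].
  move=> y0 yr; exists (y / w); split.
  - by rewrite mulrC divfK // gt_eqF.
  - by rewrite mulf_neq0 // invr_neq0 // gt_eqF.
  - by rewrite normrM normfV (gtr0_norm w0) ler_pdivrMr // mulrC.
have [ep [-> ep0 epr]] := red h h0 hr; have [de [-> de0 der]] := red k k0 kr.
have sq (y z : R) : `|y| <= Num.sqrt rho -> `|z| <= Num.sqrt rho -> `|y * z| <= rho.
  move=> yr zr; rewrite normrM -[leRHS]sqr_sqrtr ?(ltW rho0) // expr2.
  by rewrite ler_pM.
have ep2 : ep ^+ 2 <= rho by rewrite expr2 (le_trans (ler_norm _)) // sq.
have de2 : de ^+ 2 <= rho by rewrite expr2 (le_trans (ler_norm _)) // sq.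
have ep2' : 0 < ep ^+ 2 by rewrite exprn_even_gt0.
have de2' : 0 < de ^+ 2 by rewrite exprn_even_gt0.
have Db (y : R) : - rho <= y <= rho -> nneg_itv (b + y).
  by move=> yr; apply: D; lra.
have db : nneg_itv b by rewrite -[b]addr0; apply: Db; lra.
(* all quotients at b with increment in [-rho, rho] lie between the extreme
   ones, so the second factor below is at most twice the jump at b *)
have sl (y z : R) : - rho <= y -> y <= z -> z <= rho -> y != 0 -> z != 0 ->
    slope f b y <= slope f b z.
  by move=> *; apply: (slope_mono Cf db) => //; apply: Db; lra.
have edr : - rho <= ep * de <= rho by rewrite -ler_norml sq.
have B1 : slope f b (ep ^+ 2) <= slope f b rho by apply: sl; rewrite ?gt_eqF //; lra.
have B2 : slope f b (de ^+ 2) <= slope f b rho by apply: sl; rewrite ?gt_eqF //; lra.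
have B3 : slope f b (- rho) <= slope f b (ep * de).
  by case/andP: edr => *; apply: sl; rewrite ?oppr_eq0 ?mulf_neq0 ?(gt_eqF rho0) //.
have xq : `|x| <= q by rewrite /q; lra.
have xb : `|x| <= b by lra.
have qw : sym_itv alpha (q + w ^+ 2) by rewrite w2.
have be : sym_itv alpha (b + ep ^+ 2) by apply: (Db _ _).2; lra.
have bd : sym_itv alpha (b + de ^+ 2) by apply: (Db _ _).2; lra.
have := S_mono3_slopes Hf xq xb (lt0r_neq0 w0) ep0 de0 qw be bd.
rewrite exprMn w2 -/K => H.
rewrite -(ler_pM2l d0); apply: (le_trans H).
rewrite [leRHS](_ : _ = K * (2 * (slope f b rho - slope f b (- rho)))).
  by rewrite ler_wpM2l //; lra.
by field; rewrite gt_eqF.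
Qed.

End MonoDerivable.

(** * Differentiability of entrywise convex functions *)

Section ConvDerivable.
Context {R : realType} {alpha : \bar R}.
Implicit Types f : R -> R.

Lemma convex_chord_convex {D : set R} {f} :
  (forall a c l : R, D a -> D c -> a < c -> 0 <= l <= 1 ->
    f (l * c + (1 - l) * a) <= l * f c + (1 - l) * f a) -> chord_convex D f.
Proof.
move=> H a b c da dc ab bc; have ac : 0 < c - a by lra.
pose l := (b - a) / (c - a).
have lE : l * (c - a) = b - a by rewrite divfK // gt_eqF.
have l01 : 0 <= l <= 1.
  by rewrite divr_ge0 //= ?ler_pdivrMr //; lra.
have := H a c l da dc ltac:(lra) l01.
rewrite (_ : l * c + (1 - l) * a = b); last by lra.
rewrite -(ler_pM2r ac).
have -> : (l * f c + (1 - l) * f a) * (c - a) =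
    l * (c - a) * f c + (c - a - l * (c - a)) * f a by ring.
rewrite lE; lra.
Qed.

(** The hypotheses make [M + t C] positive semidefinite with entries in
    (-alpha, alpha), and increasing in [t], over the whole of [[-1, 1]]. Two-sided
    increments are needed to reach derivatives. *)
Lemma S_conv_qform {n f} {M C : 'M[R]_n} (u : 'I_n -> R) : S_conv n alpha f ->
  psdmx C -> psdmx (M - C) -> (forall i, sym_itv alpha ((M + C) i i)) ->
  chord_convex [set t | - 1 <= t <= 1] (fun t => qform (map_mx f (M + t *: C)) u).
Proof.
move=> Hf Cp MCp MCd; apply: convex_chord_convex => a c l /= a1 c1 ac l01.
have Mp (t : R) : - 1 <= t -> psdmx (M + t *: C).
  move=> t1; have -> : M + t *: C = (M - C) + (t + 1) *: C.
    by apply/matrixP => i j; rewrite !mxE; ring.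
  by apply: psdD => //; apply: psdZ => //; lra.
have Md (t : R) : - 1 <= t <= 1 -> entries_in (sym_itv alpha) (M + t *: C).
  move=> t1; have tp := Mp t ltac:(lra); apply: psd_entries_in => // i.
  apply: sym_itv_le (MCd i); rewrite ger0_norm ?psd_diag // !mxE lerD2l.
  rewrite ler_piMl ?psd_diag //; lra.
have ap := Mp a ltac:(lra); have cp := Mp c ltac:(lra).
have acp : loewner_le (M + a *: C) (M + c *: C).
  rewrite /loewner_le (_ : _ - _ = (c - a) *: C); first by apply: psdZ => //; lra.
  by apply/matrixP => i j; rewrite !mxE; ring.
have /psdP[_ /(_ u)] := Hf _ _ cp.1 ap.1 (Md c c1) (Md a a1) acp ap l l01.
rewrite qformB qformD !qformZ subr_ge0.
by congr (qform (map_mx f _) u <= _); apply/matrixP => i j; rewrite !mxE; ring.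
Qed.

Lemma S_conv_slopes {n f} {M C : 'M[R]_n} {s t : R} : S_conv n alpha f ->
  psdmx C -> psdmx (M - C) -> (forall i, sym_itv alpha ((M + C) i i)) ->
  - 1 <= s -> s <= t -> t <= 1 -> s != 0 -> t != 0 ->
  psdmx (t^-1 *: (map_mx f (M + t *: C) - map_mx f M) -
         s^-1 *: (map_mx f (M + s *: C) - map_mx f M)).
Proof.
move=> Hf Cp MCp MCd s1 st t1 s0 t0; apply/psdP; split.
  have Ms : M^T = M by rewrite -[M](subrK C) linearD /= MCp.1 Cp.1.
  have S (r : R) : (M + r *: C)^T = M + r *: C by rewrite linearD linearZ /= Cp.1 Ms.
  by rewrite linearB !linearZ /= ![(_ - map_mx _ _)^T]linearB /= !map_mx_sym.
move=> u; have := slope_mono (S_conv_qform u Hf Cp MCp MCd) (x := 0) (h := s) (k := t).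
rewrite /slope !add0r scale0r addr0 /= => /(_ ltac:(lra) ltac:(lra) ltac:(lra) s0 t0 st).
by rewrite qformB !qformZ !qformB subr_ge0 ![_^-1 * _]mulrC.
Qed.

Lemma S_conv_chord_convex {f} : S_conv 2 alpha f ->
  chord_convex (nneg_itv (alpha := alpha)) f.
Proof.
move=> Hf; apply: convex_chord_convex => a c l [a0 ad] [c0 cd] ac l01.
have Cp (y : R) : 0 <= y -> psdmx (const_mx y : 'M[R]_2) by exact: psd_const.
have Cd (y : R) : sym_itv alpha y -> entries_in (sym_itv alpha) (const_mx y : 'M[R]_2).
  by move=> dy i j; rewrite mxE.
have acp : loewner_le (const_mx a) (const_mx c : 'M[R]_2).
  rewrite /loewner_le (_ : _ - _ = const_mx (c - a)); last by apply/matrixP => i j; rewrite !mxE.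
  by apply: psd_const; rewrite subr_ge0 ltW.
have := psd_diag ord0 (Hf _ _ (Cp _ c0).1 (Cp _ a0).1 (Cd _ cd) (Cd _ ad) acp (Cp _ a0) l l01).
by rewrite !mxE subr_ge0.
Qed.

(** The quotients of [t |-> f[M + t C]] at [0] increase in the Loewner order; for the
    2 x 2 matrix [M] with rows [(q, x)], [(x, b)] and [C] the rank-one matrix of
    [(w, ep)] this is a determinant inequality. *)
Lemma S_conv2_slopes {f} {x b q w ep s t : R} : S_conv 2 alpha f ->
  w != 0 -> ep != 0 -> psdmx (mx2 q x b - mx2 (w ^+ 2) (w * ep) (ep ^+ 2)) ->
  sym_itv alpha (q + w ^+ 2) -> sym_itv alpha (b + ep ^+ 2) ->
  - 1 <= s -> s <= t -> t <= 1 -> s != 0 -> t != 0 ->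
  (slope f x (t * (w * ep)) - slope f x (s * (w * ep))) ^+ 2 <=
  (slope f q (t * w ^+ 2) - slope f q (s * w ^+ 2)) *
  (slope f b (t * ep ^+ 2) - slope f b (s * ep ^+ 2)).
Proof.
move=> Hf w0 ep0 MCp qd bd s1 st t1 s0 t0.
pose z (i : 'I_2) := if i == ord0 then w else ep.
have Cz : mx2 (w ^+ 2) (w * ep) (ep ^+ 2) = rank1 z.
  apply/matrixP => -[[|[|//]] i2] [[|[|//]] j2]; rewrite !mxE /z /= ?expr2 //.
  by rewrite mulrC.
rewrite Cz in MCp.
have MCd i : sym_itv alpha ((mx2 q x b + rank1 z) i i).
  by rewrite -Cz !mxE eqxx; case: ifP.
have E := S_conv_slopes Hf (psd_rank1 z) MCp MCd s1 st t1 s0 t0.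
have := quad_discr (fun a c => psd_pair ord0 ord_max a c E).
rewrite -Cz !mxE /=.
have scale (y c r : R) : c != 0 -> r != 0 -> r^-1 * (f (y + r * c) - f y) =
    c * slope f y (r * c).
  by move=> c0 r0; rewrite /slope; field; rewrite c0 r0.
rewrite !scale ?mulf_neq0 ?expf_neq0 // -!mulrBr.
rewrite exprMn [leRHS]mulrACA -[in leRHS]exprMn ler_pM2l // exprn_even_gt0 //=.
exact: mulf_neq0.
Qed.

Lemma S_conv2_derivable {f x} : S_conv 2 alpha f -> sym_itv alpha x -> derivable f x 1.
Proof.
move=> Hf /sym_itv_room[r r0 xr].
have Cf := S_conv_chord_convex Hf.
pose d : R := r / 3; have d0 : 0 < d by rewrite divr_gt0.
have x0 := normr_ge0 x.
have xd : sym_itv alpha (`|x| + 3 * d) by rewrite /d mulrC divfK.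
have D (y : R) : `|x| <= y <= `|x| + 3 * d -> nneg_itv (alpha := alpha) y.
  by move=> yx; apply: (nneg_itv_le (y := `|x| + 3 * d)); [split=> //|..]; lra.
pose q : R := `|x| + 2 * d.
have sl (y a z z' : R) : `|x| <= y - a -> y + a <= `|x| + 3 * d ->
   - a <= z -> z <= z' -> z' <= a -> z != 0 -> z' != 0 ->
    slope f y z <= slope f y z'.
  move=> ? ? ? ? ? ? ?; apply: (slope_mono Cf) => //; apply: D; lra.
pose K := slope f q d - slope f q (- d).
have K0 : 0 <= K.
  by rewrite subr_ge0; apply: (sl _ d); rewrite ?oppr_eq0 ?(gt_eqF d0) /q //; lra.
apply: (small_jumps_derivable Cf d0 xd K0).
move=> b rho rho0 pb bq.
pose w : R := Num.sqrt d; have w0 : 0 < w by rewrite sqrtr_gt0.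
have w2 : w ^+ 2 = d by rewrite sqr_sqrtr // ltW.
pose ep : R := Num.sqrt rho; have ep0 : 0 < ep by rewrite sqrtr_gt0.
have ep2 : ep ^+ 2 = rho by rewrite sqr_sqrtr // ltW.
have wep : w * ep <= d.
  by rewrite -w2 expr2 ler_pM2l // ler_sqrt //; lra.
have wep0 : 0 < w * ep by rewrite mulr_gt0.
suff H (h k : R) : h <= k -> h != 0 -> k != 0 -> `|h| <= w * ep -> `|k| <= w * ep ->
   (slope f x k - slope f x h) ^+ 2 <= K * (slope f b rho - slope f b (- rho)).
  move=> h k h0 k0 hr kr; have [hk|/ltW kh] := leP h k; last exact: H.
  by rewrite -sqrrN opprB; exact: H.
have sqd : psdmx (mx2 q x b - mx2 (w ^+ 2) (w * ep) (ep ^+ 2)).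
  rewrite (_ : _ - _ = mx2 (q - d) (x - w * ep) (b - rho)); last first.
    by apply/matrixP => i j; rewrite !mxE w2 ep2; case: ifP => // _; case: ifP.
  have xw : `|x - w * ep| <= `|x| + d.
    by rewrite (le_trans (ler_normB _ _)) // lerD2l ger0_norm // ltW.
  by apply: psd_mx2; rewrite (le_trans xw) // /q; lra.
move=> hk h0 k0; rewrite !ler_norml => /andP[h1 h2] /andP[k1 k2].
pose t : R := k / (w * ep); pose s : R := h / (w * ep).
have tE : t * (w * ep) = k by rewrite divfK // gt_eqF.
have sE : s * (w * ep) = h by rewrite divfK // gt_eqF.
have t0 : t != 0 by rewrite mulf_neq0 // invr_neq0 // gt_eqF.
have s0 : s != 0 by rewrite mulf_neq0 // invr_neq0 // gt_eqF.
have t1 : t <= 1 by rewrite ler_pdivrMr // mul1r.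
have s1 : - 1 <= s by rewrite ler_pdivlMr // mulN1r.
have st : s <= t by rewrite ler_pM2r // invr_gt0.
have qd : sym_itv alpha (q + w ^+ 2).
  by apply: (D _ _).2; rewrite w2 /q; lra.
have bd : sym_itv alpha (b + ep ^+ 2) by apply: (D _ _).2; rewrite ep2; lra.
have := S_conv2_slopes Hf (lt0r_neq0 w0) (lt0r_neq0 ep0) sqd qd bd s1 st t1 s0 t0.
rewrite tE sE w2 ep2 => /le_trans; apply.
have bound (y a : R) : 0 < a -> `|x| <= y - a -> y + a <= `|x| + 3 * d ->
    0 <= slope f y (t * a) - slope f y (s * a) <= slope f y a - slope f y (- a).
  move=> a0 y1 y2; have ta : t * a <= a by rewrite ler_piMl // ltW.
  have sa : - a <= s * a by rewrite -mulN1r ler_pM2r.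
  have sta : s * a <= t * a by rewrite ler_pM2r.
  have ta0 : t * a != 0 by rewrite mulf_neq0 // gt_eqF.
  have sa0 : s * a != 0 by rewrite mulf_neq0 // gt_eqF.
  have an0 : a != 0 by rewrite gt_eqF.
  have na0 : - a != 0 by rewrite oppr_eq0.
  have A1 : slope f y (- a) <= slope f y (s * a) by apply: (sl _ a) => //; lra.
  have A2 : slope f y (s * a) <= slope f y (t * a) by apply: (sl _ a) => //; lra.
  have A3 : slope f y (t * a) <= slope f y a by apply: (sl _ a) => //; lra.
  lra.
have /andP[Q0 Q1] := bound q d d0 ltac:(rewrite /q; lra) ltac:(rewrite /q; lra).
have /andP[B0 B1] := bound b rho rho0 ltac:(lra) ltac:(lra).
exact: ler_pM.
Qed.


End ConvDerivable.

(** * The derivative along matrix segments *)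

Section DerivativeClasses.
Context {R : realType} {alpha : \bar R}.
Implicit Types f : R -> R.

(** The derivative of [f[M + t C]] is the Schur product of [f'[M + t C]] and [C]. *)
Lemma is_derive_qform_path {n f} {M C : 'M[R]_n} {t : R} (u : 'I_n -> R) :
  differentiable_on alpha f -> entries_in (sym_itv alpha) (M + t *: C) ->
  is_derive t 1 (fun s => qform (map_mx f (M + s *: C)) u)
    (qform (hadamard (map_mx (derive1 f) (M + t *: C)) C) u).
Proof.
move=> fd Md; rewrite /qform.
have aff i j : is_derive t 1 (fun s : R => M i j + s * C i j) (C i j).
  by apply: is_derive_eq; rewrite scaler0 !add0r mul1r scaler1.
have entry i j : is_derive t 1 (fun s : R => f (M i j + s * C i j))
    (derive1 f (M i j + t * C i j) * C i j).
  have := Md i j; rewrite !mxE => /fd/derivableP fd'.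
  rewrite derive1E; exact: is_derive1_comp.
rewrite (_ : (fun s => _) = \sum_i \sum_j
    ((u i * u j) \*: (fun s : R => f (M i j + s * C i j)))); last first.
  apply/funext => s; rewrite !fct_sumE; apply: eq_bigr => i _.
  rewrite fct_sumE; apply: eq_bigr => j _; rewrite !mxE /=.
  by rewrite /GRing.scale /= mulrC.
apply: is_derive_eq.
apply: eq_bigr => i _; apply: eq_bigr => j _.
by rewrite !mxE /GRing.scale /= mulrC.
Qed.

Lemma map_mxB_sym {n f} {A B : 'M[R]_n} : A^T = A -> B^T = B ->
  (map_mx f A - map_mx f B)^T = map_mx f A - map_mx f B.
Proof. by move=> As Bs; rewrite linearB /= !map_mx_sym. Qed.

Lemma psd_segment {n} {A B : 'M[R]_n} {t : R} : psdmx B -> psdmx (A - B) -> 0 <= t ->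
  psdmx (B + t *: (A - B)).
Proof. by move=> Bp ABp t0; apply: psdD => //; apply: psdZ. Qed.

Lemma S_pos_derive_S_mono {n f} : differentiable_on alpha f ->
  S_pos n alpha (derive1 f) -> S_mono n alpha f.
Proof.
move=> fd Hf A B As Bs Ad Bd AB Bp; apply/psdP; split; first exact: map_mxB_sym.
move=> u; pose phi t := qform (map_mx f (B + t *: (A - B))) u.
have Md (t : R) : 0 <= t <= 1 -> entries_in (sym_itv alpha) (B + t *: (A - B)).
  by move=> t01; exact: entries_in_segment.
have [c [/andP[c0 c1] E]] := derive_mvt ltr01 (fun t t01 =>
  is_derive_qform_path u fd (Md t t01)).
move: E; rewrite scale1r scale0r addr0 subr0 mulr1 subrKC -qformB => ->.
apply: ((psdP _).1 _).2; apply: psd_hadamard => //; apply: Hf.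
  by apply: Md; lra.
by apply: psd_segment => //; exact: ltW.
Qed.

Lemma S_mono_derive_S_conv {n f} : differentiable_on alpha f ->
  S_mono n alpha (derive1 f) -> S_conv n alpha f.
Proof.
move=> fd Hf A B As Bs Ad Bd AB Bp l l01; apply/psdP; split.
  rewrite linearB linearD !linearZ /= !map_mx_sym //.
  by rewrite linearD !linearZ /= As Bs.
move=> u; have Md (t : R) : 0 <= t <= 1 -> entries_in (sym_itv alpha) (B + t *: (A - B)).
  by move=> t01; exact: entries_in_segment.
have := derive_mono_convex l01 (fun t t01 => is_derive_qform_path u fd (Md t t01)).
rewrite scale1r scale0r addr0 subrKC => H.
rewrite qformB qformD !qformZ subr_ge0.
rewrite (_ : l *: A + (1 - l) *: B = B + l *: (A - B)); last first.
  by apply/matrixP => i j; rewrite !mxE; ring.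
apply: H => s t s0 st t1; rewrite -subr_ge0 -qformB.
have sp := psd_segment Bp AB s0; have tp := psd_segment Bp AB (le_trans s0 st).
have -> : hadamard (map_mx (derive1 f) (B + t *: (A - B))) (A - B) -
    hadamard (map_mx (derive1 f) (B + s *: (A - B))) (A - B) =
    hadamard (map_mx (derive1 f) (B + t *: (A - B)) -
      map_mx (derive1 f) (B + s *: (A - B))) (A - B).
  by apply/matrixP => i j; rewrite !mxE mulrBl.
apply: ((psdP _).1 _).2; apply: psd_hadamard => //; apply: Hf.
- exact: tp.1.
- exact: sp.1.
- by apply: Md; lra.
- by apply: Md; lra.
- rewrite /loewner_le (_ : _ - _ = (t - s) *: (A - B)).
    by apply: psdZ => //; rewrite subr_ge0.
  by apply/matrixP => i j; rewrite !mxE; ring.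
- exact: sp.
Qed.

(** The all-ones matrix is the unit of the Schur product, so that the derivative of
    [f[A + t J]] at [0] is exactly [f'[A]]. *)
Lemma S_mono_derive_S_pos {n f} : (0 < alpha)%E -> differentiable_on alpha f ->
  S_mono n alpha f -> S_pos n alpha (derive1 f).
Proof.
move=> a0 fd Hf A Ad Ap; apply/psdP; split; first exact: map_mx_sym Ap.1.
move=> u; have [r r0 Hr] := entries_in_room a0 Ad.
have A0 : A + 0 *: const_mx 1 = A by rewrite scale0r addr0.
have A0d : entries_in (sym_itv alpha) (A + 0 *: const_mx 1) by rewrite A0.
have := is_derive_qform_path u fd A0d.
rewrite A0 (_ : hadamard _ _ = map_mx (derive1 f) A); last first.
  by apply/matrixP => i j; rewrite !mxE mulr1.
move=> /(slope_le_derive _ r0); apply => h /andP[h0 hr].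
rewrite /slope add0r A0 -qformB divr_ge0 ?(ltW h0) //.
rewrite (_ : h *: const_mx 1 = const_mx h :> 'M[R]_n); last first.
  by apply/matrixP => i j; rewrite !mxE mulr1.
have Ahd i : sym_itv alpha ((A + const_mx h) i i).
  by apply: Hr; rewrite gtr0_norm // ltW.
by have /psdP[_ ->] := S_mono_add Hf Ap (psd_const (ltW h0)) Ahd.
Qed.

(** Schur multiplication by [v v^T] is a congruence by a diagonal matrix. It is
    undone on the support of [v], and [E] vanishes elsewhere. *)
Lemma psd_hadamard_rank1_cancel {n} {E : 'M[R]_n} {v : 'I_n -> R} : E^T = E ->
  psdmx (hadamard E (rank1 v)) -> (forall i j, v i * v j = 0 -> E i j = 0) -> psdmx E.
Proof.
move=> Es /psdP[_ Hq] E0; apply/psdP; split=> // u.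
(* where v i = 0 the inverse is 0, which is harmless as E vanishes there *)
have := Hq (fun i => u i / v i); congr (0 <= _).
apply: eq_bigr => i _; apply: eq_bigr => j _; rewrite !mxE.
have [vv0|] := eqVneq (v i * v j) 0; first by rewrite (E0 _ _ vv0) !mul0r.
by rewrite mulf_eq0 negb_or => /andP[vi vj]; field; rewrite vi vj.
Qed.

(** Convexity along the segment from [B] to [B + v v^T] only compares the Schur
    products of [f'[B]] and [f'[B + v v^T]] with [v v^T]. An increment of rank one can
    be cancelled, since the entries of [B] that it leaves unchanged do not contribute
    to the difference of the derivatives. *)
Lemma S_conv_derive_rank1 {n f} {B : 'M[R]_n} {v : 'I_n -> R} :
  differentiable_on alpha f -> S_conv n alpha f -> psdmx B ->
  entries_in (sym_itv alpha) B -> entries_in (sym_itv alpha) (B + rank1 v) ->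
  psdmx (map_mx (derive1 f) (B + rank1 v) - map_mx (derive1 f) B).
Proof.
move=> fd Hf Bp Bd Ad; have Cp := psd_rank1 v; have Ap := psdD Bp Cp.
have Es := map_mxB_sym (f := derive1 f) Ap.1 Bp.1.
apply: (psd_hadamard_rank1_cancel (v := v) Es); last first.
  by move=> i j vv; rewrite !mxE vv addr0 subrr.
apply/psdP; split.
  apply/matrixP => i j; rewrite [LHS]mxE [LHS]mxE [RHS]mxE.
  by rewrite (psd_sym j i Es) (psd_sym j i Cp.1).
move=> u; pose phi t := qform (map_mx f (B + t *: rank1 v)) u.
have B0 : B + 0 *: rank1 v = B by rewrite scale0r addr0.
have B1 : B + 1 *: rank1 v = B + rank1 v by rewrite scale1r.
have Bd0 : entries_in (sym_itv alpha) (B + 0 *: rank1 v) by rewrite B0.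
have Bd1 : entries_in (sym_itv alpha) (B + 1 *: rank1 v) by rewrite B1.
have D0 := is_derive_qform_path u fd Bd0; have D1 := is_derive_qform_path u fd Bd1.
have AB : loewner_le B (B + rank1 v) by rewrite /loewner_le addrAC subrr add0r.
have chord (l : R) : 0 <= l <= 1 -> phi l <= l * phi 1 + (1 - l) * phi 0.
  move=> l01; have /psdP[_ /(_ u)] := Hf _ _ Ap.1 Bp.1 Ad Bd AB Bp l l01.
  rewrite qformB qformD !qformZ subr_ge0 /phi B0 B1.
  rewrite (_ : l *: (B + rank1 v) + (1 - l) *: B = B + l *: rank1 v) //.
  by apply/matrixP => i j; rewrite !mxE; ring.
have le0 := derive_le_slope (c := phi 1 - phi 0) _ ltr01 D0.
have le1 := slope_left_le_derive (c := phi 1 - phi 0) _ ltr01 D1.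
rewrite (_ : hadamard _ _ = hadamard (map_mx (derive1 f) (B + 1 *: rank1 v)) (rank1 v)
  - hadamard (map_mx (derive1 f) (B + 0 *: rank1 v)) (rank1 v)); last first.
  by rewrite B0 B1; apply/matrixP => i j; rewrite !mxE mulrBl.
rewrite qformB subr_ge0; apply: (@le_trans _ _ (phi 1 - phi 0)).
  apply: le0 => h /andP[h0 h1]; rewrite /slope add0r -/(phi h) -/(phi 0).
  rewrite ler_pdivrMr //; have := chord h ltac:(lra); lra.
apply: le1 => h /andP[h0 h1]; rewrite /slope -/(phi (1 - h)) -/(phi 1).
rewrite invrN mulrN -mulNr opprB ler_pdivlMr //.
have := chord (1 - h) ltac:(lra); lra.
Qed.

(** [A - B] is added to [B] one rank-one summand at a time. The intermediate matrices
    lie below [A], so their diagonals, and hence all their entries, stay in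
    (-alpha, alpha). *)
Lemma S_conv_derive_S_mono {n f} : differentiable_on alpha f ->
  S_conv n alpha f -> S_mono n alpha (derive1 f).
Proof.
move=> fd Hf A B _ _ Ad _ /psd_sum_rank1[s Es] Bp; rewrite /loewner_le.
move: Ad; rewrite -[A](subrKC B) {}Es.
elim: s B Bp => [|v s IH] B Bp Ad; first by rewrite big_nil addr0 subrr; exact: psd0.
rewrite big_cons addrA in Ad *.
have B'p := psdD Bp (psd_rank1 v).
have Sp : psdmx (\sum_(w <- s) rank1 w) by apply: psd_sum => w; exact: psd_rank1.
have B'd := entries_in_summand B'p Sp Ad.
have Bd := entries_in_summand Bp (psd_rank1 v) B'd.
have := psdD (IH _ B'p Ad) (S_conv_derive_rank1 fd Hf Bp Bd B'd).
by rewrite subrKA.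
Qed.

End DerivativeClasses.

(** * The characterizations *)

Theorem theorem3p2 (R : realType) (alpha : \bar R) (halpha : (0 < alpha)%E)
    (f : R -> R) :
  (forall n : nat, (2 <= n)%N ->
     S_conv n alpha f <->
     (differentiable_on alpha f /\ S_mono n alpha (derive1 f))) /\
  (forall n : nat, (3 <= n)%N ->
     S_mono n alpha f <->
     (differentiable_on alpha f /\ S_pos n alpha (derive1 f))).
Proof.
split=> n n_big; split.
- move=> Hf; have fd : differentiable_on alpha f.
    by move=> x; exact: S_conv2_derivable (S_conv_smaller n_big Hf).
  by split=> //; exact: S_conv_derive_S_mono.
- by case=> fd; exact: S_mono_derive_S_conv.
- move=> Hf; have fd : differentiable_on alpha f.
    by move=> x; exact: S_mono3_derivable (S_mono_smaller n_big Hf).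
  by split=> //; exact: S_mono_derive_S_pos.
- by case=> fd; exact: S_pos_derive_S_mono.
Qed.
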